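(* Let $\mathcal{C}$ be a nowhere dense class of graphs, let $d$ be a positive integer, let $\varepsilon$ be a positive real, and let $\varphi(x,y)$ be a first-order formula (in the language of graphs) with two free variables. Then there is an integer $k_0$ such that for every graph $G$ in $\mathcal{C}$ and all vertex subsets $A, B\subseteq V(G)$ satisfying $|A \cup B|\geq k_0$, there exist disjoint sets $A' \subseteq A$ and $B'\subseteq B$ such that $$|A'| \ge (1-\varepsilon)\cdot |A|,\qquad |B'| \ge \frac{|B|}{|A \cup B|^{\varepsilon}},$$ and for every $a \in A'$, either $G\models \varphi(a,b)$ for all $b\in B'$, or $G\models \neg \varphi(a,b)$ for all $b\in B'$.
   Context: All graphs are finite, simple and undirected. The radius of a connected graph $H$ is the least integer $r$ for which some vertex of $H$ is at distance at most $r$ from every vertex of $H$. For a partition $\mathcal{X}$ of $V(G)$ into nonempty parts inducing connected subgraphs, $G/\mathcal{X}$ is the graph with vertex set $\mathcal{X}$ in which two distinct parts $X,Y$ are adjacent if $G$ has an edge with one endpoint in $X$ and the other in $Y$. A graph $H$ is a depth-$r$ minor of $G$ if $H$ is isomorphic to a subgraph of $G/\mathcal{X}$ for some partition $\mathcal{X}$ of $V(G)$ into nonempty parts inducing connected subgraphs of radius at most $r$. A class of graphs $\mathcal{C}$ is nowhere dense if for each integer $r\geq 0$ there exists a graph which is not a depth-$r$ minor of any graph from $\mathcal{C}$. First-order formulas on graphs have variables ranging over vertices, atomic formulas $x=y$ and $\mathsf{adj}(x,y)$ (equality and adjacency of vertices), and are closed under boolean connectives and existential and universal quantification. $G\models\varphi(a,b)$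 means that $\varphi$ holds in $G$ when $x$ is evaluated to $a$ and $y$ to $b$. *)

(* Defs.v *)
From mathcomp Require Import all_boot all_order all_algebra.
From mathcomp Require Import reals exp.

Set Implicit Arguments.
Unset Strict Implicit.
Unset Printing Implicit Defensive.

Record graph : Type := Graph {
  vertex :> finType;
  adj : rel vertex;
  adj_sym : symmetric adj;
  adj_irr : irreflexive adj
}.

Section Distance.
Variable H : graph.

Definition connected : bool := [forall x : H, forall y : H, connect (@adj H) x y].

Definition walk (n : nat) (x y : H) : bool :=
  [exists p : n.-tuple H, path (@adj H) x p && (last x p == y)].

(* Distances between connected vertices are < #|H|, so the search bound is
   harmless; the value is #|H| exactly when y is not reachable from x. *)
Definition dist (x y : H) : nat := find (fun n => walk n x y) (iota 0 #|H|).

(* Only meaningful when H is connected and nonempty; the radius is then < #|H|. *)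
Definition radius : nat :=
  find (fun r => [exists c : H, forall v : H, dist c v <= r]) (iota 0 #|H|).

End Distance.

Section Induced.
Variables (G : graph) (X : {set G}).

Definition induced_adj : rel {x : G | x \in X} :=
  fun u v => adj (val u) (val v).

Fact induced_adj_sym : symmetric induced_adj.
Proof. by move=> u v; rewrite /induced_adj adj_sym. Qed.

Fact induced_adj_irr : irreflexive induced_adj.
Proof. by move=> u; rewrite /induced_adj adj_irr. Qed.

Definition induced : graph := Graph induced_adj_sym induced_adj_irr.

End Induced.

Section Contraction.
Variables (G : graph) (P : {set {set G}}).

Definition contract_adj : rel {X : {set G} | X \in P} :=
  fun X Y => (X != Y) &&
    [exists x in val X, exists y in val Y, adj x y].

Fact contract_adj_sym : symmetric contract_adj.
Proof.
move=> X Y; rewrite /contract_adj eq_sym; congr (_ && _).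
by apply/idP/idP => /exists_inP[x xX /exists_inP[y yY xy]];
  apply/exists_inP; exists y => //; apply/exists_inP; exists x => //;
  rewrite adj_sym.
Qed.

Fact contract_adj_irr : irreflexive contract_adj.
Proof. by move=> X; rewrite /contract_adj eqxx. Qed.

Definition contract : graph := Graph contract_adj_sym contract_adj_irr.

End Contraction.

(* H is isomorphic to a (not necessarily induced) subgraph of K. *)
Definition subgraph_iso (H K : graph) : Prop :=
  exists2 f : H -> K, injective f & forall x y : H, adj x y -> adj (f x) (f y).

(* [partition] already requires the parts to be nonempty. *)
Definition depth_minor (r : nat) (H G : graph) : Prop :=
  exists P : {set {set G}},
    [/\ partition P [set: G],
        forall X, X \in P -> connected (induced X) /\ radius (induced X) <= r
      & subgraph_iso H (contract P)].

Definition nowhere_dense (C : graph -> Prop) : Prop :=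
  forall r : nat, exists H : graph, forall G : graph, C G -> ~ depth_minor r H G.

(* First-order formulas of the language of graphs whose free variables are
   among n variables, indexed by 'I_n. A quantifier binds variable 0 of its body,
   the free variables being shifted by one. *)
Inductive formula : nat -> Type :=
| FEq n (i j : 'I_n) : formula n
| FAdj n (i j : 'I_n) : formula n
| FNot n (f : formula n) : formula n
| FAnd n (f g : formula n) : formula n
| FOr n (f g : formula n) : formula n
| FExists n (f : formula n.+1) : formula n
| FForall n (f : formula n.+1) : formula n.

Fixpoint sat (G : graph) (n : nat) (f : formula n) : n.-tuple G -> bool :=
  match f in formula m return m.-tuple G -> bool with
  | FEq _ i j => fun v => tnth v i == tnth v j
  | FAdj _ i j => fun v => adj (tnth v i) (tnth v j)
  | FNot _ f => fun v => ~~ sat f v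
  | FAnd _ f g => fun v => sat f v && sat g v
  | FOr _ f g => fun v => sat f v || sat g v
  | FExists _ f => fun v => [exists a : G, sat f [tuple of a :: v]]
  | FForall _ f => fun v => [forall a : G, sat f [tuple of a :: v]]
  end.

(* G |= phi(a, b), the variables x and y having indices 0 and 1. *)
Definition models2 (G : graph) (phi : formula 2) (a b : G) : bool :=
  sat phi [tuple a; b].

(* Main.v *)
Require Import Defs.
From mathcomp Require Import all_boot all_order all_algebra zify lra.
From mathcomp Require Import reals exp.

(** Two ingredients. (1) Metric part: deleting a bounded set S of vertices, one
    finds a subset U of B of size at least |B| / n^(eps/2), up to a constant, such
    that all but a small fraction of A is at distance more than r from U.
    As long as some ball of bounded radius contains a constant fraction of B, take
    such a vertex s with the least possible radius, isolate it and restrict B to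
    its ball; minimality makes the walks from B to s spread out, so that after t
    rounds disjoint connections from t vertices of B to all the deleted vertices
    give a shallow clique minor of order t. Hence the process stops, and then no
    bounded ball carries a constant fraction of B. Balls grown in B until they
    grow by a factor at most n^(eps/2) are then light in A as well, and a suitable
    bundle of them is U.
    (2) Logical part (Gaifman locality): the truth of phi(a, b) for far apart a and
    b depends only on the local types of a and of b in the graph with S isolated,
    coloured by the adjacencies to S. The number of local types is bounded, so the
    pigeonhole principle applied to U yields B'. *)

Set Implicit Arguments.
Unset Strict Implicit.
Unset Printing Implicit Defensive.

(** * Local back-and-forth equivalence *)

Section WalkDistance.
Variable V : finType.
Implicit Types (e : rel V) (x y z : V) (A B U : {set V}).

(** Distance at most [n] in an arbitrary relation, so that one vertex type serves the graph, its
    version with isolated vertices and its restrictions to branch sets. *)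
Fixpoint dle e n x y : bool :=
  if n is m.+1 then (x == y) || [exists z, e x z && dle e m z y] else x == y.

Lemma dle_refl e n x : dle e n x x.
Proof. by case: n => [|n] /=; rewrite eqxx. Qed.

Lemma dle_step e n x z y : e x z -> dle e n z y -> dle e n.+1 x y.
Proof. by move=> xz zy /=; apply/orP; right; apply/existsP; exists z; rewrite xz. Qed.

Lemma dleS_inv e n x y :
  dle e n.+1 x y -> x = y \/ exists2 z, e x z & dle e n z y.
Proof.
by case/orP=> [/eqP|/existsP[z /andP[xz zy]]]; [left | right; exists z].
Qed.

Lemma dle_mono e m n x y : m <= n -> dle e m x y -> dle e n x y.
Proof.
elim: m n x => [|m IH] [|n] x //= mn; first by move=> ->.
case/orP=> [->//|/existsP[z /andP[xz zy]]].
by apply/orP; right; apply/existsP; exists z; rewrite xz IH.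
Qed.

Lemma dle_sub e e' n x y : subrel e e' -> dle e n x y -> dle e' n x y.
Proof.
move=> ee'; elim: n x => [|n IH] x //=.
case/orP=> [->//|/existsP[z /andP[xz zy]]].
by apply/orP; right; apply/existsP; exists z; rewrite ee' ?IH.
Qed.

Lemma dle_trans e m n x y z : dle e m x y -> dle e n y z -> dle e (m + n) x z.
Proof.
elim: m x => [|m IH] x; first by move=> /eqP ->.
case/dleS_inv=> [->|[t xt ty]] yz; first exact: dle_mono (leq_addl _ _) yz.
by rewrite addSn; apply: dle_step xt _; apply: IH.
Qed.

Lemma dle_sym e : symmetric e -> forall n x y, dle e n x y = dle e n y x.
Proof.
move=> es; suff H n x y : dle e n x y -> dle e n y x.
  by move=> n x y; apply/idP/idP; apply: H.
elim: n x y => [|n IH] x y; first by move=> /eqP ->; apply: dle_refl.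
case/dleS_inv=> [->|[z xz zy]]; first exact: dle_refl.
rewrite -addn1; apply: dle_trans (IH _ _ zy) _.
by apply: dle_step (dle_refl _ _ _); rewrite es.
Qed.

Lemma dle1 e x y : dle e 1 x y = (x == y) || e x y.
Proof.
rewrite /=; congr (_ || _); apply/existsP/idP => [[z /andP[xz /eqP <-]]//|xy].
by exists y; rewrite xy eqxx.
Qed.

Lemma dle_path e n x y : dle e n x y ->
  exists p, [/\ path e x p, last x p = y & size p <= n].
Proof.
elim: n x => [|n IH] x; first by move=> /eqP ->; exists [::].
case/dleS_inv=> [->|[z xz /IH[p [pp lp sp]]]]; first by exists [::].
by exists (z :: p); rewrite /= xz.
Qed.

End WalkDistance.

Section LocalTypes.
Variables (V K : finType) (e : rel V) (kap : V -> K).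
Hypothesis e_sym : symmetric e.
Implicit Types (z : seq (V * V)) (p : V * V).

(** Comparing all distances up to [D] makes a legal move on one side legal on the other; [n = 0]
    records equality and, for positive [D], [n = 1] records adjacency in [e] up to equality. *)
Definition same_atoms D z := forall p p', p \in z -> p' \in z ->
  kap p.1 = kap p.2 /\ forall n, n <= D -> dle e n p.1 p'.1 = dle e n p.2 p'.2.

(* Back-and-forth equivalence of the two tuples listed in parallel by [z], all
   moves being made at distance at most [D] from the vertices already played. *)
Fixpoint loceq D q z : Prop :=
  same_atoms D z /\
  if q is q'.+1 then
    (forall p w, p \in z -> dle e D p.1 w -> exists w', loceq D q' ((w, w') :: z))
    /\ (forall p w', p \in z -> dle e D p.2 w' ->
          exists w, loceq D q' ((w, w') :: z))
  else True.

Lemma loceq_atoms D q z : loceq D q z -> same_atoms D z.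
Proof. by case: q => [|q] []. Qed.

Lemma loceq_sub D q z z' : {subset z' <= z} -> loceq D q z -> loceq D q z'.
Proof.
have sub_at z1 z2 : {subset z2 <= z1} -> same_atoms D z1 -> same_atoms D z2.
  by move=> s at1 p p' /s pz /s p'z; apply: at1.
elim: q z z' => [|q IH] z z' s [a m]; split=> //; try exact: sub_at a.
have sc p0 : {subset p0 :: z' <= p0 :: z}.
  by move=> p; rewrite !inE => /orP[->//|/s ->]; rewrite orbT.
by case: m => m1 m2; split=> p w /s pz pw;
  [case: (m1 p w pz pw) | case: (m2 p w pz pw)] => w' h; exists w'; apply: IH h.
Qed.

Lemma loceq_mono D D' q q' z : D <= D' -> q <= q' ->
  loceq D' q' z -> loceq D q z.
Proof.
move=> DD'; have mono_at z1 : same_atoms D' z1 -> same_atoms D z1.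
  move=> a p p' pz p'z; have [k h] := a _ _ pz p'z; split=> // n nD.
  by apply: h; apply: leq_trans DD'.
elim: q q' z => [|q IH] [|q'] z // qq' [a m]; split=> //; try exact: mono_at.
by case: m => m1 m2; split=> p w pz pw;
  [case: (m1 p w pz (dle_mono DD' pw)) | case: (m2 p w pz (dle_mono DD' pw))]
  => w' h; exists w'; apply: IH h.
Qed.

Definition swap p := (p.2, p.1).

Lemma loceq_swap D q z : loceq D q z -> loceq D q (map swap z).
Proof.
have swap_at z1 : same_atoms D z1 -> same_atoms D (map swap z1).
  move=> a _ _ /mapP[p pz ->] /mapP[p' p'z ->] /=.
  by have [k h] := a _ _ pz p'z; split=> [|n nD]; rewrite ?k ?h.
elim: q z => [|q IH] z [a m]; split=> //; try exact: swap_at.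
by case: m => m1 m2; split=> _ w /mapP[p pz ->] pw;
  [case: (m2 p w pz pw) | case: (m1 p w pz pw)] => w' h; exists w'; apply: (IH _ h).
Qed.

(** The answer in one game is a legal move in the other, since distances up to [D] agree. The
    triples list three tuples in parallel. *)
Lemma loceq_trans D q (t : seq (V * V * V)) :
  loceq D q [seq (x.1.1, x.1.2) | x <- t] ->
  loceq D q [seq (x.1.2, x.2) | x <- t] ->
  loceq D q [seq (x.1.1, x.2) | x <- t].
Proof.
have tr_at t1 : same_atoms D [seq (x.1.1, x.1.2) | x <- t1] ->
  same_atoms D [seq (x.1.2, x.2) | x <- t1] ->
  same_atoms D [seq (x.1.1, x.2) | x <- t1].
  move=> a b _ _ /mapP[x xt ->] /mapP[y yt ->] /=.
  have [k h] := a _ _ (map_f _ xt) (map_f _ yt).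
  have [k' h'] := b _ _ (map_f _ xt) (map_f _ yt).
  by split=> [|n nD]; [rewrite k k' | rewrite h ?h'].
elim: q t => [|q IH] t [a m] [b n]; split=> //; try exact: tr_at.
case: m n => m1 m2 [n1 n2]; split=> _ w /mapP[x xt ->] /= xw.
  have [w' h] := m1 _ w (map_f _ xt) xw.
  have xw' : dle e D x.1.2 w'.
    have [_ d] := loceq_atoms h (mem_behead (s := _ :: _) (map_f _ xt)) (mem_head _ _).
    by rewrite -d.
  have [w'' h'] := n1 _ w' (map_f _ xt) xw'.
  by exists w''; apply: (IH ((w, w', w'') :: t)).
have [w' h] := n2 _ w (map_f _ xt) xw.
have xw' : dle e D x.1.2 w'.
  have [_ d] := loceq_atoms h (mem_behead (s := _ :: _) (map_f _ xt)) (mem_head _ _).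
  by have /= -> := d D (leqnn _).
have [w'' h'] := m2 _ w' (map_f _ xt) xw'.
by exists w''; apply: (IH ((w'', w', w) :: t)).
Qed.

Lemma loceq_diag D q z : (forall p, p \in z -> p.1 = p.2) -> loceq D q z.
Proof.
have dg_at z1 : (forall p, p \in z1 -> p.1 = p.2) -> same_atoms D z1.
  by move=> h p p' /h -> /h ->.
elim: q z => [|q IH] z h; split=> //; try exact: dg_at.
by split=> p w pz pw; exists w; apply: IH => p'; rewrite inE => /orP[/eqP ->|/h].
Qed.

Definition far d z z' := forall p p', p \in z -> p' \in z' ->
  ~~ dle e d p.1 p'.1 /\ ~~ dle e d p.2 p'.2.

Lemma far_sym d z z' : far d z z' -> far d z' z.
Proof.
by move=> h p p' pz p'z; rewrite !(dle_sym e_sym d p.1) !(dle_sym e_sym d p.2); apply: h.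
Qed.

Lemma far_cons D d z z' p w : p \in z ->
  dle e D p.1 w.1 -> dle e D p.2 w.2 ->
  far (D + d) z z' -> far d (w :: z) z'.
Proof.
move=> pz pw1 pw2 h p1 p'; rewrite inE => /orP[/eqP ->|p1z] p'z.
  have [h1 h2] := h p p' pz p'z.
  by split; [apply: contra h1 | apply: contra h2]; apply: dle_trans.
have [h1 h2] := h p1 p' p1z p'z.
by split; [apply: contra h1 | apply: contra h2]; apply: dle_mono; lia.
Qed.

Lemma same_atoms_cat D z z' : far D z z' ->
  same_atoms D z -> same_atoms D z' -> same_atoms D (z ++ z').
Proof.
move=> f a a' p p'; rewrite !mem_cat => pz /orP[] p'z; split.
- by case/orP: pz => [/a/(_ p'z)[]//|pz]; have [] := a' _ _ pz pz.
- move=> n nD; case/orP: pz => pz; first by have [_] := a _ _ pz p'z; apply.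
  have [/negP f1 /negP f2] := far_sym f pz p'z.
  by apply/idP/idP => h; [case: f1 | case: f2]; apply: dle_mono h.
- by case/orP: pz => [pz|pz]; [have [] := a _ _ pz pz | have [] := a' _ _ pz pz].
- move=> n nD; case/orP: pz => pz; last by have [_] := a' _ _ pz p'z; apply.
  have [/negP f1 /negP f2] := f _ _ pz p'z.
  by apply/idP/idP => h; [case: f1 | case: f2]; apply: dle_mono h.
Qed.

Lemma loceq_near D q z p w : p \in z -> loceq D q (w :: z) ->
  dle e D p.1 w.1 = dle e D p.2 w.2.
Proof.
move=> pz /loceq_atoms a.
by have [_] := a p w (mem_behead (s := _ :: _) pz) (mem_head _ _); apply.
Qed.

(** The two games are played independently. A round reduces the separation by at most [D], so
    [D * q.+1] leaves the sides more than [D] apart to the end, and no distance up to [D] is ever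
    realised across. *)
Lemma loceq_cat D q z z' : far (D * q.+1) z z' ->
  loceq D q z -> loceq D q z' -> loceq D q (z ++ z').
Proof.
elim: q z z' => [|q IH] z z' f h h'.
  by split=> //; apply: same_atoms_cat; [rewrite -(muln1 D) | case: h | case: h'].
have f1 : far D z z'.
  move=> p p' pz p'z; have [h1 h2] := f p p' pz p'z.
  by split; [apply: contra h1 | apply: contra h2]; apply: dle_mono; rewrite mulnS leq_addr.
split; first by apply: same_atoms_cat => //; [apply: loceq_atoms h | apply: loceq_atoms h'].
have hq : loceq D q z by apply: loceq_mono h.
have hq' : loceq D q z' by apply: loceq_mono h'.
have swp w : {subset w :: z ++ z' <= z ++ w :: z'}.
  by move=> p; rewrite !(inE, mem_cat) orbCA.
have fc p w : far (D * q.+2) z z' -> p \in z -> dle e D p.1 w.1 -> dle e D p.2 w.2 ->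
   far (D * q.+1) (w :: z) z'.
  by rewrite mulnS => ff pz pw1 pw2; apply: (far_cons pz pw1 pw2 ff).
have fc' p w : far (D * q.+2) z z' -> p \in z' -> dle e D p.1 w.1 -> dle e D p.2 w.2 ->
   far (D * q.+1) z (w :: z').
  by rewrite mulnS => ff pz pw1 pw2; apply: far_sym; apply: (far_cons pz pw1 pw2 (far_sym ff)).
case: (h) => _ [m1 m2]; case: (h') => _ [m1' m2'].
split=> p w; rewrite mem_cat => /orP[] pz pw.
- have [w' g] := m1 p w pz pw; exists w'; apply: (IH ((w, w') :: z)) => //.
  by apply: (fc p) => //; have /= <- := loceq_near pz g.
- have [w' g] := m1' p w pz pw; exists w'; apply: loceq_sub (swp _) _.
  by apply: IH => //; apply: (fc' p) => //; have /= <- := loceq_near pz g.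
- have [w' g] := m2 p w pz pw; exists w'; apply: (IH ((w', w) :: z)) => //.
  by apply: (fc p) => //; have /= -> := loceq_near pz g.
- have [w' g] := m2' p w pz pw; exists w'; apply: loceq_sub (swp _) _.
  by apply: IH => //; apply: (fc' p) => //; have /= -> := loceq_near pz g.
Qed.

End LocalTypes.

(** * Gaifman locality *)

Section Scattered.
Variables (V : finType) (e : rel V).
Hypothesis e_sym : symmetric e.

Definition scattered d (E : {set V}) :=
  [forall x in E, forall y in E, (x != y) ==> ~~ dle e d x y].

Lemma scatteredP d (E : {set V}) :
  reflect (forall x y, x \in E -> y \in E -> x != y -> ~~ dle e d x y)
          (scattered d E).
Proof.
apply: (iffP forall_inP) => h x; last first.
  by move=> xE; apply/forall_inP => y yE; apply/implyP; apply: h.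
by move=> y xE yE; apply/implyP; move/(_ x xE)/forall_inP: h; apply.
Qed.

(** Two vertices of [E] within [d] of the same [v] would be at distance at most [d + d], so choosing
    such a [v] for each vertex is injective. *)
Lemma scattered_card d (E : {set V}) (s : seq V) : scattered (d + d) E ->
  (forall y, y \in E -> exists2 v, v \in s & dle e d v y) -> #|E| <= size s.
Proof.
move=> /scatteredP sc h.
pose f y := nth y s (find (fun v => dle e d v y) s).
have fP y : y \in E -> f y \in s /\ dle e d (f y) y.
  move=> /h [v vs vy]; have hs : has (fun v => dle e d v y) s by apply/hasP; exists v.
  by split; [rewrite mem_nth // -has_find | have := nth_find y hs].
have inj : {in E &, injective f}.
  move=> x y xE yE fxy; apply/eqP; apply: contraT => xy.
  have [_ h1] := fP x xE; have [_ h2] := fP y yE.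
  have := sc x y xE yE xy; rewrite (dle_trans (y := f x)) //.
    by rewrite dle_sym.
  by rewrite fxy.
rewrite -(card_in_imset inj); apply: leq_trans (card_size s).
by apply: subset_leq_card; apply/subsetP => _ /imsetP[y yE ->]; case: (fP y yE).
Qed.

Lemma scattered_setU1 d (E : {set V}) x : scattered d E ->
  (forall y, y \in E -> ~~ dle e d x y) -> scattered d (x |: E).
Proof.
move=> /scatteredP sc h; apply/scatteredP => a b /setU1P[->|aE] /setU1P[->|bE] ab.
- by rewrite eqxx in ab.
- exact: h.
- by rewrite dle_sym ?h.
- exact: sc.
Qed.

End Scattered.

Section Gaifman.
Variables (V K : finType) (e : rel V) (kap : V -> K).
Hypothesis e_sym : symmetric e.
Local Notation loceq := (loceq e kap).

(** Each vertex of [E] is within reach of [z], so one round of the game copies it to the left. *)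
Lemma loceq_replay D q z (E : {set V}) : loceq D (#|E| + q) z ->
  (forall y, y \in E -> exists2 p, p \in z & dle e D p.2 y) ->
  exists t : seq (V * V), [/\ loceq D q (t ++ z), map snd t =i E,
     uniq (map snd t) & size t = #|E|].
Proof.
move En: #|E| => n; elim: n E En q => [|n IH] E En q h hE.
  by exists [::]; split=> // x; move/eqP: En; rewrite cards_eq0 => /eqP ->; rewrite inE.
have /card_gt0P[y yE] : 0 < #|E| by rewrite En.
have En' : #|E :\ y| = n by move: (cardsD1 y E); rewrite yE En; lia.
have [|y' /setD1P[_ /hE//]|t [ht tE ut st]] := IH _ En' q.+1; first by rewrite addnS.
have [p pz py] := hE y yE.
have ptz : p \in t ++ z by rewrite mem_cat pz orbT.
case: (ht) => _ [_ m]; have [x hx] := m p y ptz py.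
exists ((x, y) :: t); split=> //=.
- by move=> v; rewrite inE tE !inE; case: eqP => [->|].
- by rewrite ut tE !inE eqxx.
- by rewrite st.
Qed.

Lemma loceq_sym1 D q a b : loceq D q [:: (a, b)] -> loceq D q [:: (b, a)].
Proof. by move/loceq_swap. Qed.

Lemma loceq_trans1 D q a b c :
  loceq D q [:: (a, b)] -> loceq D q [:: (b, c)] -> loceq D q [:: (a, c)].
Proof. by move=> h1 h2; apply: (loceq_trans (t := [:: (a, b, c)])). Qed.

Lemma loceq_mem1 D q z p : p \in z -> loceq D q z -> loceq D q [:: p].
Proof. by move=> pz; apply: loceq_sub => p'; rewrite inE => /eqP ->. Qed.

(* Far away, [w] can be answered by a vertex of the same local type: otherwise
   all vertices of this type are close to the right-hand tuple, and a maximum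
   scattered set of them, copied to the left, could be enlarged by [w]. *)
Lemma loceq_extend D f N z w : size z <= N ->
  loceq (3 * (D * f.+1)) (f + N.+1) z ->
  exists w', loceq D f ((w, w') :: z).
Proof.
set F := D * f.+1; move=> zN h.
have DF : D <= 3 * F by rewrite /F; nia.
have hz : loceq D f z by apply: loceq_mono h => //; lia.
case nw: (has (fun p => dle e (3 * F) p.1 w) z).
  have /hasP[p pz pw] := nw; move: h; rewrite addnS => -[_ [m _]].
  by have [w' h] := m p w pz pw; exists w'; apply: loceq_mono h => //; lia.
have {}nw p : p \in z -> ~~ dle e (3 * F) p.1 w.
  by move=> pz; apply: contraFN nw => pw; apply/hasP; exists p.
(* A vertex of the type of [w] far from the right-hand tuple is a valid answer, by gluing two
   separate games. *)
case nw': [exists w', [forall p, (p \in z) ==> ~~ dle e F p.2 w'] &&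
    boolp.asbool (loceq D f [:: (w, w')])].
  have /existsP[w' /andP[/forallP fa /boolp.asboolP hw]] := nw'.
  exists w'; apply: (loceq_cat e_sym (z := [:: (w, w')])) => // p p'.
  rewrite inE => /eqP -> p'z; rewrite !(dle_sym e_sym _ _ p'.1) !(dle_sym e_sym _ _ p'.2).
  split; last by have /implyP := fa p'; apply.
  by apply: contra (nw p' p'z); apply: dle_mono; rewrite /F; lia.
have close y : loceq D f [:: (w, y)] -> exists2 p, p \in z & dle e F p.2 y.
  move=> hy; have : ~~ [forall p, (p \in z) ==> ~~ dle e F p.2 y].
    apply: contraFN nw' => fa; apply/existsP; exists y; rewrite fa /=.
    by apply/boolp.asboolP.
  case/forallPn => p; rewrite negb_imply negbK => /andP[pz py]; by exists p.
(* Such a set has at most [N] elements: each lies within [F] of the right-hand tuple, and two of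
   them cannot be close to the same entry. *)
pose P (E : {set V}) := scattered e (F + F) E &&
   [forall y in E, boolp.asbool (loceq D f [:: (w, y)])].
have P0 : P set0.
  by apply/andP; split; [apply/scatteredP => x y | apply/forall_inP => x]; rewrite inE.
case: (arg_maxnP (fun E : {set V} => #|E|) P0) => E /andP[sE /forall_inP tE] maxE.
have clE y : y \in E -> exists2 p, p \in z & dle e F p.2 y.
  by move=> /tE/boolp.asboolP/close.
have EN : #|E| <= N.
  apply: leq_trans zN; rewrite -(size_map snd).
  apply: scattered_card e_sym _ _ _ sE _ => y /clE[p pz py].
  by exists p.2 => //; apply: map_f.
(* Copying [E] takes at most [N] of the [f + N.+1] rounds; those left over ensure that the copies
   keep the type of [w]. *)
have [||t [ht tE' ut st]] := @loceq_replay (3 * F) f.+1 z E.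
- by apply: loceq_mono h => //; lia.
- by move=> y /clE[p pz py]; exists p => //; apply: dle_mono py; lia.
have at_t := loceq_atoms ht.
have tt p : p \in t -> p \in t ++ z by rewrite mem_cat => ->.
have tz p : p \in z -> p \in t ++ z by rewrite mem_cat orbC => ->.
pose E' := [set x in map fst t].
have E'P x : x \in E' -> exists2 p, p \in t & x = p.1.
  by rewrite inE => /mapP.
have t2E p : p \in t -> p.2 \in E by rewrite -tE'; apply: map_f.
have ti p p' : p \in t -> p' \in t -> p.2 = p'.2 -> p = p'.
  elim: (t) ut => // a s IH /= /andP[na us]; rewrite !inE.
  by case/orP=> [/eqP ->|ps] /orP[/eqP ->|ps'] // E2; [| |exact: IH];
   case/negP: na; [rewrite E2 | rewrite -E2]; apply: map_f.
(* The copies lie within [F] of the left-hand tuple and [w] is not within [3 * F] of it: hence the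
   factor 3. *)
have wE' x : x \in E' -> ~~ dle e (F + F) w x.
  move=> /E'P[p pt ->]; have [p' p'z py] := clE _ (t2E p pt).
  have [_ a] := at_t p' p (tz _ p'z) (tt _ pt).
  apply: contra (nw p' p'z) => wp; have -> : 3 * F = F + (F + F) by lia.
  by apply: dle_trans (_ : dle e F p'.1 p.1) _; [rewrite a //; lia | rewrite dle_sym].
have : P (w |: E').
  apply/andP; split.
    apply: scattered_setU1 => //; apply/scatteredP => x y /E'P[p pt ->] /E'P[p' p't ->] pp'.
    have [_ a] := at_t p p' (tt _ pt) (tt _ p't).
    rewrite a; last by lia.
    apply: (scatteredP _ _ _ sE); try exact: t2E.
    by apply: contraNneq pp' => /ti -> //.
  apply/forall_inP => y /setU1P[->|/E'P[p pt ->]]; apply/boolp.asboolP.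
    by apply: loceq_diag => p; rewrite inE => /eqP ->.
  apply: (loceq_trans1 (b := p.2)); first by apply/boolp.asboolP; apply: tE; apply: t2E.
  apply: loceq_sym1; case: (p) pt => a b pt.
  by apply: (loceq_mono _ _ (loceq_mem1 (tt _ pt) ht)); lia.
move=> /maxE /=; rewrite leqNgt => /negP[].
suff eE : #|E'| = #|E|.
  by rewrite cardsU1 eE; case: (boolP (w \in E')) => // /wE'; rewrite dle_refl.
rewrite cardsE (card_uniqP _) ?size_map // map_inj_in_uniq.
  exact: map_uniq ut.
move=> p p' pt p't E1; apply: ti => //; apply/eqP; apply: contraT => ne.
have [_ a] := at_t p p' (tt _ pt) (tt _ p't).
have /scatteredP := sE => /(_ _ _ (t2E _ pt) (t2E _ p't) ne).
by rewrite -a ?E1 ?dle_refl //; lia.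
Qed.

Lemma loceq_extend_rev D f N z w' : size z <= N ->
  loceq (3 * (D * f.+1)) (f + N.+1) z ->
  exists w, loceq D f ((w, w') :: z).
Proof.
move=> zN /loceq_swap h; have [|w /loceq_swap /= hw] := loceq_extend w' _ h.
  by rewrite size_map.
exists w; move: hw; rewrite -map_comp map_id_in // => -[a b] //.
Qed.

End Gaifman.

(** * Finitely many local types *)

Section LocalTypeCodes.
Variables (V K : finType) (e : rel V) (kap : V -> K) (D : nat).

(** Only [K], [D], [q] and [k] enter, so the cardinality bounds the number of local types uniformly
    over all graphs. *)
Fixpoint ltype (q k : nat) : finType :=
  let atoms : finType :=
    ({ffun 'I_k * 'I_k * 'I_D.+1 -> bool} * {ffun 'I_k -> K})%type in
  if q is q'.+1 then (atoms * {set ltype q' k.+1})%type : finType else atoms.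

Definition atom_code k (u : k.-tuple V) :=
  ([ffun x : 'I_k * 'I_k * 'I_D.+1 => dle e x.2 (tnth u x.1.1) (tnth u x.1.2)],
   [ffun i : 'I_k => kap (tnth u i)]).

Fixpoint code q k : k.-tuple V -> ltype q k :=
  match q return k.-tuple V -> ltype q k with
  | q'.+1 => fun u => (atom_code u,
      [set code q' [tuple of w :: u] | w in [pred w | [exists i, dle e D (tnth u i) w]]])
  | 0 => fun u => atom_code u
  end.

Lemma tnth_zip k (u v : k.-tuple V) p : p \in zip u v ->
  exists i, p = (tnth u i, tnth v i).
Proof.
case: p => a b /(nthP (a, b))[j]; rewrite size_zip !size_tuple minnn => jk <-.
exists (Ordinal jk); rewrite nth_zip ?size_tuple //.
by rewrite (tnth_nth a) (tnth_nth b).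
Qed.

Lemma zip_tnth k (u v : k.-tuple V) i : (tnth u i, tnth v i) \in zip u v.
Proof.
have x := tnth u i; apply/(nthP (x, x)); exists i.
  by rewrite size_zip !size_tuple minnn.
by rewrite nth_zip ?size_tuple // -!tnth_nth.
Qed.

Lemma atom_code_same k (u v : k.-tuple V) :
  atom_code u = atom_code v -> same_atoms e kap D (zip u v).
Proof.
case=> /ffunP ed /ffunP ek _ _ /tnth_zip[i ->] /tnth_zip[j ->] /=; split.
  by have := ek i; rewrite !ffunE.
by move=> n nD; have := ed (i, j, inord n); rewrite !ffunE /= inordK.
Qed.

Lemma code_loceq q k (u v : k.-tuple V) :
  code q u = code q v -> loceq e kap D q (zip u v).
Proof.
elim: q k u v => [|q IH] k u v; first by move/atom_code_same.
move=> E; have /atom_code_same a : atom_code u = atom_code v := congr1 fst E.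
have {}E : (code q.+1 u).2 = (code q.+1 v).2 := congr1 snd E.
have near_code (x : k.-tuple V) i w : dle e D (tnth x i) w ->
    code q [tuple of w :: x] \in (code q.+1 x).2.
  by move=> iw; apply: imset_f; rewrite inE; apply/existsP; exists i.
split=> //; split=> _ w /tnth_zip[i ->] /near_code.
  by rewrite E => /imsetP[w' _ /IH]; exists w'.
by rewrite -E => /imsetP[w' _ /esym/IH]; exists w'.
Qed.

End LocalTypeCodes.

Lemma pigeonhole_fiber (V T : finType) (f : V -> T) (B : {set V}) :
  exists B' : {set V}, [/\ B' \subset B, #|B| <= #|T| * #|B'| &
    {in B' &, forall x y, f x = f y}].
Proof.
have [->|[b bB]] := set_0Vmem B.
  by exists set0; split=> [||x y]; rewrite ?sub0set ?cards0 // inE.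
case: (@arg_maxnP _ (f b) predT (fun t => #|[set x in B | f x == t]|)) => // t _ mx.
exists [set x in B | f x == t]; split.
- by apply/subsetP => x; rewrite inE => /andP[].
- rewrite -sum1_card (partition_big f predT) //= -sum_nat_const.
  apply: leq_sum => s _; apply: leq_trans (mx s isT).
  by rewrite sum1_card; apply: eq_leq; apply: eq_card => x; rewrite !inE.
- by move=> x y; rewrite !inE => /andP[_ /eqP ->] /andP[_ /eqP ->].
Qed.

(** * Local equivalence preserves first-order formulas *)

Fixpoint qdepth n (f : formula n) : nat :=
  match f with
  | FEq _ _ _ | FAdj _ _ _ => 0
  | FNot _ f => qdepth f
  | FAnd _ f g | FOr _ f g => maxn (qdepth f) (qdepth g)
  | FExists _ f | FForall _ f => (qdepth f).+1
  end.

(* The radius and the number of rounds for which local equivalence forces two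
   tuples to agree on all formulas of quantifier depth [q], the total number of
   variables being at most [N]. *)
Fixpoint locality N q : nat * nat :=
  if q is q'.+1 then
    let: (D, f) := locality N q' in (3 * (D * f.+1), f + N.+1)
  else (1, 0).

Lemma locality_gt0 N q : 0 < (locality N q).1.
Proof. by elim: q => //= q; case: (locality N q) => D f /= h; rewrite !muln_gt0 h. Qed.

Section Satisfaction.
Variables (G : graph) (K : finType) (e : rel G) (kap : G -> K).
Hypothesis e_sym : symmetric e.
Hypothesis adj_atoms : forall z p p', same_atoms e kap 1 z ->
  p \in z -> p' \in z -> adj p.1 p'.1 = adj p.2 p'.2.
Variable N : nat.

(** A quantifier may pick a vertex far from the tuple, a move the local game forbids; [loceq_extend]
    answers it at the price of one level of [locality]. Distances are measured in [e], and
    [adj_atoms] recovers adjacency in [G]. *)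
Lemma sat_loceq n (f : formula n) q (u v : n.-tuple G) :
  qdepth f <= q -> n + q <= N ->
  loceq e kap (locality N q).1 (locality N q).2 (zip u v) -> sat f u = sat f v.
Proof.
have at1 m q1 (u1 v1 : m.-tuple G) :
  loceq e kap (locality N q1).1 (locality N q1).2 (zip u1 v1) ->
  same_atoms e kap 1 (zip u1 v1).
  by move=> h; apply: (@loceq_atoms _ _ _ _ _ 0); apply: loceq_mono h => //; apply: locality_gt0.
elim: n / f q u v => [n i j|n i j|n f IH|n f IHf g IHg|n f IHf g IHg|n f IH|n f IH] q u v /=.
- move=> _ _ /at1 a; have [_ h] := a _ _ (zip_tnth u v i) (zip_tnth u v j).
  exact: (h 0).
- move=> _ _ /at1 a; exact: (adj_atoms a (zip_tnth u v i) (zip_tnth u v j)).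
- by move=> fq nN h; rewrite (IH q u v).
- by rewrite geq_max => /andP[fq gq] nN h; rewrite (IHf q u v) ?(IHg q u v).
- by rewrite geq_max => /andP[fq gq] nN h; rewrite (IHf q u v) ?(IHg q u v).
- case: q => // q fq nN; rewrite /=; case El: (locality N q) => [D r] /= h.
  have sz : size (zip u v) <= N by rewrite size_zip !size_tuple minnn; lia.
  apply/existsP/existsP => -[a ha].
    have [a' h'] := loceq_extend e_sym a sz h; exists a'.
    by rewrite -(IH q [tuple of a :: u]) ?El //; lia.
  have [a' h'] := loceq_extend_rev e_sym a sz h; exists a'.
  by rewrite (IH q _ [tuple of a :: v]) ?El //; lia.
- case: q => // q fq nN; rewrite /=; case El: (locality N q) => [D r] /= h.
  have sz : size (zip u v) <= N by rewrite size_zip !size_tuple minnn; lia.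
  apply/forallP/forallP => ha a.
    have [a' h'] := loceq_extend_rev e_sym a sz h.
    by rewrite -(IH q [tuple of a' :: u]) ?El //; lia.
  have [a' h'] := loceq_extend e_sym a sz h.
  by rewrite (IH q _ [tuple of a' :: v]) ?El //; lia.
Qed.

End Satisfaction.

(** * Isolating a bounded set of vertices *)

Definition isolate (G : graph) (S : seq G) : rel G :=
  fun x y => [&& adj x y, x \notin S & y \notin S].

Lemma isolate_sym (G : graph) (S : seq G) : symmetric (isolate S).
Proof. by move=> x y; rewrite /isolate adj_sym [(x \notin S) && _]andbC. Qed.

(* Isolating the vertices of [S] instead of deleting them keeps the vertex type;
   the colours remember the removed edges. *)
Definition isolate_color (G : graph) (S : seq G) t (v : G) :=
  [ffun i : 'I_t => let s := nth v S i in
     ((i < size S) && (v == s), (i < size S) && adj v s)].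

(** The colours identify each vertex of [S] and its neighbours, which settles adjacencies meeting
    [S]. Outside [S], being adjacent means being at distance at most 1 but not 0 in [isolate S]. *)
Lemma isolate_atoms (G : graph) (S : seq G) t z p p' : size S <= t ->
  same_atoms (isolate S) (isolate_color S t) 1 z ->
  p \in z -> p' \in z -> adj p.1 p'.1 = adj p.2 p'.2.
Proof.
move=> St a pz p'z.
have col r : r \in z -> (forall i, i < size S ->
    (r.1 == nth r.1 S i) = (r.2 == nth r.1 S i) /\
    adj r.1 (nth r.1 S i) = adj r.2 (nth r.1 S i)).
  move=> rz i iS; have [/ffunP h _] := a r r rz rz.
  have := h (Ordinal (leq_trans iS St)); rewrite !ffunE /= iS /=.
  (* The colours of [r.1] and [r.2] use different default values, which are harmless as
     [i < size S]. *)
  by rewrite (set_nth_default r.1 r.2 iS) => -[].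
have inS r : r \in z -> r.1 \in S -> r.2 = r.1.
  move=> rz rS; have := rS; rewrite -index_mem => iS.
  have [] := col r rz _ iS; rewrite nth_index // eqxx => /esym/eqP //.
have inS' r : r \in z -> r.2 \in S -> r.1 = r.2.
  move=> rz rS; have := rS; rewrite -index_mem => iS.
  have [] := col r rz _ iS; rewrite nth_index // eqxx => /eqP //.
have adjS r s : r \in z -> s \in S -> adj r.1 s = adj r.2 s.
  move=> rz sS; have := sS; rewrite -index_mem => iS.
  by have [_] := col r rz _ iS; rewrite nth_index.
have [pS|pS] := boolP (p.1 \in S).
  by rewrite (inS p pz pS) ![adj p.1 _]adj_sym; apply: adjS.
have [p'S|p'S] := boolP (p'.1 \in S).
  by rewrite (inS p' p'z p'S); apply: adjS.
have pS2 : p.2 \notin S by apply: contra pS => h; rewrite (inS' p pz h).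
have pS2' : p'.2 \notin S by apply: contra p'S => h; rewrite (inS' p' p'z h).
have [_ d] := a p p' pz p'z; have := d 0 isT; have := d 1 isT; rewrite !dle1 /=.
rewrite /isolate pS p'S pS2 pS2' /= !andbT => h1 h0; move: h1; rewrite h0.
case: (p.2 =P p'.2) h0 => [->|_ _] //= /eqP ->.
by rewrite !adj_irr.
Qed.

(** * Shallow clique minors from apices *)

Definition restrict (V : finType) (e : rel V) (X : {set V}) : rel V :=
  fun x y => [&& e x y, x \in X & y \in X].

(** It turns a witness into a bound on [dist] or [radius], even when the witness lies beyond the
    search range. *)
Lemma find_iota (P : pred nat) m n : P n -> find P (iota 0 m) <= n.
Proof.
move=> Pn; have [nm|mn] := ltnP n m; last first.
  by apply: leq_trans (find_size _ _) _; rewrite size_iota.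
rewrite leqNgt; apply/negP => lt.
by have := before_find 0 lt; rewrite nth_iota // add0n Pn.
Qed.

Lemma dle_induced (G : graph) (X : {set G}) n (x y : induced X) :
  dle (restrict (@adj G) X) n (val x) (val y) -> dle (@adj (induced X)) n x y.
Proof.
elim: n x => [|n IH] x; first by move/eqP/val_inj ->; apply: dle_refl.
case/dleS_inv => [/val_inj ->|[z /and3P[xz _ zX] zy]]; first exact: dle_refl.
by apply: (dle_step (z := exist _ z zX)) => //; apply: IH.
Qed.

Lemma radius_induced (G : graph) (X : {set G}) n c : c \in X ->
  (forall x, x \in X -> dle (restrict (@adj G) X) n c x) ->
  connected (induced X) /\ radius (induced X) <= n.
Proof.
move=> cX h; pose c' : induced X := exist _ c cX.
have d x : dle (@adj (induced X)) n c' x by apply: dle_induced; apply: h; apply: valP.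
split.
  apply/forallP => x; apply/forallP => y.
  have cx z : connect (@adj (induced X)) c' z.
    by have [p [pp <- _]] := dle_path (d z); apply/connectP; exists p.
  apply: connect_trans (cx y).
  by rewrite (sym_connect_sym (@adj_sym (induced X))).
apply: find_iota; apply/existsP; exists c'; apply/forallP => v.
have [p [pp lp sp]] := dle_path (d v); apply: leq_trans sp.
apply: find_iota; apply/existsP; exists (in_tuple p).
by rewrite pp lp eqxx.
Qed.

(** The sets [W h] need not cover [G]; every remaining vertex becomes a singleton part. *)
Lemma depth_minor_of_branch_sets n (H G : graph) (W : H -> {set G}) :
  (forall h, exists2 c, c \in W h &
     forall x, x \in W h -> dle (restrict (@adj G) (W h)) n c x) ->
  (forall h h', h != h' -> [disjoint W h & W h']) ->
  (forall h h', h != h' -> exists x y, [/\ x \in W h, y \in W h' & adj x y]) ->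
  depth_minor n H G.
Proof.
move=> star dis adjW.
have disE h h' x : x \in W h -> x \in W h' -> h = h'.
  move=> xh xh'; apply/eqP; apply: contraT => /dis/disjointFr/(_ xh).
  by rewrite xh'.
pose g x := if [pick h | x \in W h] is Some h then W h else [set x].
have gW h x : x \in W h -> g x = W h.
  rewrite /g; case: pickP => [h' xh' xh|/(_ h) -> //].
  by rewrite (disE _ _ _ xh xh').
have gx x : x \in g x.
  by rewrite /g; case: pickP => // _; rewrite inE.
have gg x y : y \in g x -> g y = g x.
  rewrite {1}/g; case: pickP => [h xh yh|_]; last by rewrite inE => /eqP ->.
  by rewrite (gW h) // (gW h).
pose P := g @: [set: G].
have WP h : W h \in P.
  by have [c ch _] := star h; rewrite -(gW h c ch); apply: imset_f.
exists P; split.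
- apply/and3P; split.
  + apply/eqP/setP => x; rewrite inE; apply/bigcupP.
    by exists (g x) => //; apply: imset_f.
  + apply/trivIsetP => _ _ /imsetP[x _ ->] /imsetP[y _ ->] ne.
    apply/pred0P => z /=; apply/negP => /andP[/gg zx /gg zy].
    by move: ne; rewrite -zx zy eqxx.
  + by apply/negP => /imsetP[x _ E]; have := gx x; rewrite -E inE.
- move=> _ /imsetP[x _ ->]; rewrite /g; case: pickP => [h _|_].
    by have [c ch hc] := star h; apply: radius_induced hc.
  apply: (@radius_induced _ _ _ x); first by rewrite inE.
  by move=> y; rewrite inE => /eqP ->; apply: dle_refl.
- exists (fun h => exist _ (W h) (WP h) : contract P).
    move=> h h' [E]; have [c ch _] := star h.
    by apply: (disE h h' c) => //; rewrite -E.
  move=> h h' hh'; have ne : h != h'.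
    by apply: contraTneq hh' => ->; rewrite adj_irr.
  have [x [y [xh yh xy]]] := adjW h h' ne; apply/andP; split.
    apply: contra ne => /eqP[E]; apply/eqP.
    by apply: (disE h h' x) => //; rewrite -E.
  by apply/exists_inP; exists x => //; apply/exists_inP; exists y.
Qed.

Lemma restrict_subset (V : finType) (e : rel V) (X Y : {set V}) :
  X \subset Y -> subrel (restrict e X) (restrict e Y).
Proof. by move=> /subsetP XY x y /and3P[xy xX yX]; rewrite /restrict xy !XY. Qed.

Lemma card_bigcup_le (I V : finType) (P : pred I) (F : I -> {set V}) :
  #|\bigcup_(i | P i) F i| <= \sum_(i | P i) #|F i|.
Proof.
elim/big_rec2: _ => [|i n X _ h]; first by rewrite cards0.
by apply: leq_trans (leq_card_setU _ _) _; rewrite leq_add2l.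
Qed.

(** [T] consists of the vertices of a walk from [b] to [s], stopped just before its first visit to
    [s]. *)
Lemma dle_path_set (V : finType) (e : rel V) n b s : dle e n b s -> b != s ->
  exists T : {set V}, [/\ b \in T, s \notin T, #|T| <= n,
    forall x, x \in T -> dle (restrict e T) n.-1 b x &
    exists2 y, y \in T & e y s].
Proof.
elim: n b => [|n IH] b; first by move/eqP ->; rewrite eqxx.
case/dleS_inv => [->|[z bz zs]] bs; first by rewrite eqxx in bs.
have [zs'|zs'] := eqVneq z s.
  exists [set b]; rewrite in_set1 eqxx cards1 in_set1 eq_sym bs -zs'; split=> //.
    by move=> x; rewrite inE => /eqP ->; apply: dle_refl.
  by exists b; rewrite ?inE.
have [T [zT sT cT dT [y yT ys]]] := IH z zs zs'.
exists (b |: T); split.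
- by rewrite setU11.
- by rewrite !inE negb_or sT andbT eq_sym.
- by apply: leq_trans (leq_card_setU _ _) _; rewrite cards1.
- move=> x /setU1P[->|xT]; first exact: dle_refl.
  have n0 : 0 < n by case: (n) zs => //= /eqP E; rewrite E eqxx in zs'.
  rewrite -(prednK n0) /=; apply: (dle_step (z := z)).
    by rewrite /restrict bz setU11 !inE zT orbT.
  by apply: dle_sub (dT x xT); apply: restrict_subset; apply: subsetUr.
- by exists y; rewrite // !inE yT orbT.
Qed.

(* The last clause spreads out the walks from [B] to [s]: no other vertex can lie
   on more than a [1/Q] fraction of them. *)
Definition apex (G : graph) R Q (B : {set G}) (s : G) : Prop :=
  exists e : rel G, exists r : nat,
    [/\ symmetric e, subrel e (@adj G), r <= R,
        (s \notin B) /\ (forall b, b \in B -> dle e r b s)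
      & forall z, z != s -> #|[set b in B | dle e r.-1 z b]| * Q <= #|B|].

(** For each [s], a vertex [b] is bad if it is within [r.-1] of a vertex of [Z] other than [s]; the
    last clause of [apex], summed over [Z], bounds their number. For a good [b], a walk to [s]
    stopped before [s] stays within [r.-1] of [b] and so misses [Z]. *)
Lemma apex_avoid (G : graph) R Q (B Z : {set G}) (S : seq G) :
  (forall s, s \in S -> apex R Q B s) ->
  exists Bad : {set G}, #|Bad| * Q <= size S * #|Z| * #|B| /\
    forall b, b \in B -> b \notin Bad -> forall s, s \in S ->
      exists T : {set G}, [/\ b \in T, [disjoint T & Z], #|T| <= R,
        forall x, x \in T -> dle (restrict (@adj G) T) R b x &
        exists2 y, y \in T & adj y s].
Proof.
elim: S => [|s S IH] hS; first by exists set0; rewrite cards0 mul0n.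
have [|Bad [cB hB]] := IH; first by move=> s' s'S; apply: hS; rewrite inE s'S orbT.
have [e [r [es ea rR [sB Br] hz]]] := hS s (mem_head _ _).
pose C := \bigcup_(z | (z \in Z) && (z != s)) [set b in B | dle e r.-1 z b].
have cC : #|C| * Q <= #|Z| * #|B|.
  apply: leq_trans (leq_mul (card_bigcup_le _ _) (leqnn Q)) _.
  rewrite big_distrl /=; apply: (@leq_trans (\sum_(z | (z \in Z) && (z != s)) #|B|)).
    by apply: leq_sum => z /andP[_ zs]; apply: hz.
  rewrite sum_nat_const leq_mul2r; apply/orP; right.
  by apply: subset_leq_card; apply/subsetP => z /andP[].
exists (Bad :|: C); split.
  apply: leq_trans (leq_mul (leq_card_setU _ _) (leqnn Q)) _.
  rewrite mulnDl /= mulSn mulnDl addnC; exact: leq_add.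
move=> b bB; rewrite inE negb_or => /andP[bBad bC] s'.
rewrite inE => /orP[/eqP ->|s'S]; last exact: hB.
have bs : b != s by apply: contraNneq sB => <-.
have [T [bT sT cT dT [y yT ys]]] := dle_path_set (Br b bB) bs.
exists T; split=> //; last 3 first.
- exact: leq_trans rR.
- move=> x xT; apply: dle_mono (leq_trans (leq_pred r) rR) _.
  by apply: dle_sub (dT x xT) => u v /and3P[/ea uv uT vT]; apply/and3P.
- by exists y; rewrite ?ea.
apply/pred0P => z /=; apply/negP => /andP[zT zZ].
have zs : z != s by apply: contraNneq sT => <-.
case/negP: bC; apply/bigcupP; exists z; first by rewrite zZ.
rewrite inE bB dle_sym //; apply: dle_sub (dT z zT).
by move=> u v /and3P[].
Qed.

Definition branch (G : graph) R n (S : seq G) (Z U : {set G}) : Prop :=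
  [/\ [disjoint U & Z], #|U| <= n,
      exists2 c, c \in U & forall x, x \in U -> dle (restrict (@adj G) U) R c x
    & forall s, s \in S -> exists2 y, y \in U & adj y s].

(** Since [size S * #|Z| < Q], some vertex of [B] is not bad. The union of its walks to all of [S]
    is a branch set centred at it. *)
Lemma apex_branch (G : graph) R Q (B Z : {set G}) (S : seq G) :
  (forall s, s \in S -> apex R Q B s) -> S != [::] -> B != set0 ->
  size S * #|Z| < Q -> exists U, branch R (size S * R).+1 S Z U.
Proof.
move=> hS S0 B0 hQ; have [Bad [cBad hBad]] := apex_avoid Z hS.
have [b bB bBad] : exists2 b, b \in B & b \notin Bad.
  apply/subsetPn; apply: contraTN (cBad) => BB.
  rewrite -ltnNge mulnC [in X in _ < X]mulnC; apply: (@leq_trans (#|B| * Q)).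
    by rewrite ltn_mul2l card_gt0 B0.
  by rewrite mulnC leq_mul2l subset_leq_card ?orbT.
have {}hBad := hBad b bB bBad.
have bZ : b \notin Z.
  case: (S) S0 hBad => // s S' _ /(_ s (mem_head _ _))[T [bT dT _ _ _]].
  by rewrite (disjointFr dT bT).
suff [U [bU [dU cU hU aU]]] : exists U : {set G}, b \in U /\
    [/\ [disjoint U & Z], #|U| <= (size S * R).+1,
    forall x, x \in U -> dle (restrict (@adj G) U) R b x
    & forall s, s \in S -> exists2 y, y \in U & adj y s].
  by exists U; split=> //; exists b.
clear -hBad bZ; elim: S hBad => [|s S IH] h.
  exists [set b]; rewrite set11 cards1; split=> //; split=> //.
    by rewrite disjoints1.
  by move=> x; rewrite inE => /eqP ->; apply: dle_refl.
have [|U [bU [dU cU hU aU]]] := IH; first by move=> s' s'S; apply: h; rewrite inE s'S orbT.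
have [T [bT dT cT hT [y yT ys]]] := h s (mem_head _ _).
exists (T :|: U); split; first by rewrite inE bT.
split.
- by rewrite -setI_eq0 setIUl (disjoint_setI0 dT) (disjoint_setI0 dU) setU0.
- by apply: leq_trans (leq_card_setU _ _) _; rewrite /= mulSn -addnS leq_add.
- move=> x /setUP[/hT|/hU]; apply: dle_sub; apply: restrict_subset.
    exact: subsetUl.
  exact: subsetUr.
- move=> s'; rewrite inE => /orP[/eqP ->|/aU[y' y'U y's]].
    by exists y; rewrite // inE yT.
  by exists y'; rewrite // inE y'U orbT.
Qed.

(** With [t] apices, the set to avoid contains these and at most [t] branch sets of size at most
    [(t * R).+1]; the bound exceeds [t] times its size. *)
Definition apex_bound t R := (t * (t + t * (t * R).+1)).+1.

(** Take disjoint branch sets, one per apex, each avoiding all apices and adjacent to all of them.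
    Joining each to its own apex gives a clique minor on [#|H|] vertices: every branch set is
    adjacent to the apex of every other. The apex adds one to the depth. *)
Lemma apex_minor (H G : graph) R (B : {set G}) (S : seq G) :
  uniq S -> size S = #|H| -> B != set0 ->
  (forall s, s \in S -> apex R (apex_bound #|H| R) B s) ->
  depth_minor R.+1 H G.
Proof.
move=> uS sS B0 hS.
have [t0|tpos] := posnP #|H|.
  have no (h : H) : False by have := card0_eq t0 h.
  by apply: (@depth_minor_of_branch_sets _ _ _ (fun=> set0)) => h; case: (no h).
pose SS := [set x in S].
have cSS : #|SS| <= #|H| by rewrite -sS cardsE card_size.
have S0 : S != [::] by rewrite -size_eq0 sS -lt0n.
pose L := (#|H| * R).+1.
(* The branch sets are built greedily, each avoiding the apices and its predecessors. *)
have claim : forall j, j <= #|H| -> exists U : nat -> {set G},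
    (forall i, i < j -> branch R L S SS (U i)) /\
    (forall i k, i < j -> k < j -> i != k -> [disjoint U i & U k]).
  elim=> [|j IH] jt; first by exists (fun=> set0).
  have [U [hU dU]] := IH (ltnW jt).
  pose Z := SS :|: \bigcup_(i < j) U i.
  have cZ : #|Z| <= #|H| + #|H| * L.
    apply: leq_trans (leq_card_setU _ _) (leq_add cSS _).
    apply: leq_trans (card_bigcup_le _ _) _.
    apply: (@leq_trans (\sum_(i < j) L)).
      by apply: leq_sum => i _; case: (hU i (ltn_ord i)).
    by rewrite sum_nat_const card_ord leq_mul2r (ltnW jt) orbT.
  have [|U' [dZ cU stU aU]] := @apex_branch G R _ B Z S hS S0 B0.
    by rewrite sS ltnS leq_mul2l cZ orbT.
  exists (fun i => if i == j then U' else U i); split=> [i|i k].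
    rewrite ltnS leq_eqVlt; case: eqP => [_ _|_ /= /hU //]; split=> //.
      by apply: disjointWr dZ; apply: subsetUl.
    by rewrite /L -sS.
  have new i1 : i1 < j -> [disjoint U' & U i1].
    move=> ij; apply: disjointWr dZ; apply: subset_trans (subsetUr _ _).
    exact: (bigcup_sup (Ordinal ij)).
  rewrite !ltnS (leq_eqVlt i) (leq_eqVlt k).
  case: eqP => [->|_]; case: eqP => [->|_] //=; rewrite ?eqxx //.
  - by move=> _ kj _; apply: new.
  - by move=> ij _ _; rewrite disjoint_sym; apply: new.
  - exact: dU.
have [U [hU dU]] := claim _ (leqnn _).
have [s0 _] : exists s0, s0 \in S.
  by case: (S) S0 => // s ? _; exists s; apply: mem_head.
pose ix (h : H) := nat_of_ord (enum_rank h).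
have ixlt h : ix h < #|H| by apply: ltn_ord.
have ixinj h h' : h != h' -> ix h != ix h'.
  by apply: contra => /eqP/val_inj/enum_rank_inj ->.
pose a h := nth s0 S (ix h).
have aS h : a h \in S by rewrite mem_nth // sS.
have aU h h' : a h \notin U (ix h').
  have [d _ _ _] := hU _ (ixlt h'); rewrite (disjointFl d) //.
  by rewrite inE.
have aa h h' : h != h' -> a h != a h' by move=> hh'; rewrite nth_uniq ?sS ?ixinj.
apply: (@depth_minor_of_branch_sets _ _ _ (fun h => a h |: U (ix h))).
- move=> h; have [_ _ [c cU stc] /(_ _ (aS h))[y yU ya]] := hU _ (ixlt h).
  exists c => [|x]; first by rewrite !inE cU orbT.
  have sub : subrel (restrict (@adj G) (U (ix h))) (restrict (@adj G) (a h |: U (ix h))).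
    by apply: restrict_subset; apply: subsetUr.
  case/setU1P => [->|xU]; last first.
    by apply: dle_mono (leqnSn _) _; apply: dle_sub sub _; apply: stc.
  rewrite -addn1; apply: dle_trans (dle_sub sub (stc y yU)) _.
  by rewrite dle1 /restrict ya !inE yU eqxx orbT /= orbT.
- move=> h h' hh'; apply/pred0P => x /=; apply/negP => /andP[].
  case/setU1P => [->|xU] /setU1P[E|xU'].
  + by move: (aa _ _ hh'); rewrite E eqxx.
  + by move: (aU h h'); rewrite xU'.
  + by move: (aU h' h); rewrite -E xU.
  + by move: (disjointFr (dU _ _ (ixlt h) (ixlt h') (ixinj _ _ hh')) xU); rewrite xU'.
- move=> h h' hh'; have [_ _ _ /(_ _ (aS h'))[y yU ya]] := hU _ (ixlt h).
  by exists y, (a h'); rewrite !inE yU eqxx orbT.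
Qed.

(** * Isolating apices until all balls are light *)

Definition light (V : finType) R c (e : rel V) (B : {set V}) :=
  [forall z, #|[set b in B | (b != z) && dle e R z b]| * c < #|B|].

Lemma apex_step (G : graph) R c Q (S : seq G) (B : {set G}) :
  0 < c -> 0 < Q -> 2 * Q * ((2 * Q) ^ R * c) <= #|B| ->
  ~~ light R c (isolate S) B ->
  exists (s : G) (B1 : {set G}), [/\ s \notin S, B1 \subset B, apex R Q B1 s &
    #|B| <= (2 * Q) ^ R * c * #|B1|].
Proof.
move=> c0 Q0 Bbig hl; pose e := isolate S.
have es : symmetric e := isolate_sym S.
pose pb r z := [set b in B | (b != z) && dle e r z b].
(* The threshold for being a heavy ball grows by a factor [2 * Q] for each unit the
   radius decreases, so the centre of a heavy ball of least radius is an apex. *)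
pose cc r := (2 * Q) ^ (R - r) * c.
have cc0 r : 0 < cc r by rewrite muln_gt0 c0 expn_gt0 muln_gt0 Q0.
have ccR r : cc r <= (2 * Q) ^ R * c.
  by rewrite leq_mul2r leq_pexp2l ?leq_subr ?orbT // muln_gt0.
have B0 : 0 < #|B|.
  by apply: leq_trans Bbig; rewrite !muln_gt0 c0 expn_gt0 muln_gt0 Q0.
pose P r := (r <= R) && [exists z, #|B| <= #|pb r z| * cc r].
have exP : exists r, P r.
  exists R; rewrite /P leqnn /= /cc subnn expn0 mul1n.
  by move: hl; case/forallPn => z; rewrite -leqNgt => h; apply/existsP; exists z.
case: (ex_minnP exP) => r /andP[rR /existsP[s hs]] minr.
have r0 : 0 < r.
  rewrite lt0n; apply: contraTneq hs => ->; rewrite -ltnNge.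
  suff -> : pb 0 s = set0 by rewrite cards0.
  by apply/setP => b; rewrite !inE /= (eq_sym s); case: eqP; rewrite ?andbF.
pose B1 := pb r s.
have B1B : B1 \subset B by apply/subsetP => b; rewrite inE => /andP[].
have hB : #|B| <= (2 * Q) ^ R * c * #|B1|.
  by apply: leq_trans hs _; rewrite mulnC leq_mul2r ccR orbT.
have QB1 : 2 * Q <= #|B1|.
  have C0 : 0 < (2 * Q) ^ R * c by apply: leq_trans (ccR 0).
  by rewrite -(leq_pmul2r C0) [X in _ <= X]mulnC; apply: leq_trans hB.
exists s, B1; split=> //.
  (* The ball omits its centre, so a walk leads from [s] to another vertex and [s] is not yet
     isolated. *)
  have /card_gt0P[b] : 0 < #|B1| by apply: leq_trans QB1; rewrite muln_gt0.
  rewrite inE => /and3P[_ bs]; rewrite -(prednK r0).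
  by case/dleS_inv => [E|[z /and3P[_ sS _] _] //]; rewrite E eqxx in bs.
exists e, r; split=> //.
- by move=> x y /and3P[].
- split; first by rewrite inE eqxx andbF.
  by move=> b; rewrite inE dle_sym // => /and3P[].
move=> z zs.
have ltr : #|pb r.-1 z| * cc r.-1 < #|B|.
  rewrite ltnNge; apply/negP => h; have : P r.-1.
    by rewrite /P (leq_trans (leq_pred r) rR); apply/existsP; exists z.
  by move/minr; lia.
have ccr : cc r.-1 = 2 * Q * cc r.
  by rewrite /cc mulnA -expnS; congr (_ ^ _ * _); lia.
have ltr' : #|pb r.-1 z| * (2 * Q) < #|B1|.
  by rewrite -(ltn_pmul2r (cc0 r)) -mulnA -ccr; apply: leq_trans ltr hs.
(* The clause of [apex] may count the centre [z], which [pb] omits; the factor 2 in [2 * Q],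
   together with [QB1], pays for it. *)
have le1 : #|[set b in B1 | dle e r.-1 z b]| <= #|pb r.-1 z|.+1.
  apply: (@leq_trans #|z |: pb r.-1 z|).
    apply: subset_leq_card; apply/subsetP => b; rewrite !inE.
    by case/andP => /and3P[-> _ _] ->; case: eqP.
  by apply: leq_trans (leq_card_setU _ _) _; rewrite cards1.
nia.
Qed.

(** The counted sets only shrink while [B] loses at most a factor [C]. *)
Lemma apex_shrink (G : graph) R Q C (B B1 : {set G}) s : 0 < C ->
  B1 \subset B -> #|B| <= C * #|B1| -> apex R (Q * C) B s -> apex R Q B1 s.
Proof.
move=> C0 B1B hB [e [r [es ea rR [sB Br] hz]]]; exists e, r; split=> //.
  split=> [|b bB1]; first by apply: contra sB; apply/subsetP.
  by apply: Br; apply: (subsetP B1B).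
move=> z zs; rewrite -(leq_pmul2r C0) -mulnA [X in _ <= X]mulnC.
apply: leq_trans hB; apply: leq_trans (hz z zs).
rewrite leq_mul2r subset_leq_card ?orbT //.
by apply/subsetP => b; rewrite !inE => /andP[/(subsetP B1B) -> ->].
Qed.

(** Induction on the number [m] of apices still missing: each heavy ball supplies a new apex, and
    with [#|H|] apices [apex_minor] contradicts the exclusion of [H]. *)
Lemma isolate_until_light (H : graph) R c m : 0 < c -> exists Q K,
  [/\ 0 < Q, 0 < K & forall (G : graph) (S : seq G) (B : {set G}), ~ depth_minor R.+1 H G ->
  uniq S -> size S + m = #|H| -> (forall s, s \in S -> apex R Q B s) ->
  K <= #|B| -> exists (S' : seq G) (B' : {set G}),
  [/\ size S' <= #|H|, B' \subset B, #|B| <= K * #|B'| & light R c (isolate S') B']].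
Proof.
move=> c0; elim: m => [|m [Q [K [Q0 K0 IH]]]].
  exists (apex_bound #|H| R), 1; split=> // G S B nm uS sS hS B0; case: nm.
  by apply: apex_minor uS _ _ hS; [rewrite -sS addn0 | rewrite -card_gt0].
pose C := (2 * Q) ^ R * c.
have C0 : 0 < C by rewrite muln_gt0 c0 expn_gt0 muln_gt0 Q0.
(* [Q * C] keeps the old apices valid on [B1]; in the size bound [K] is what [B1] must retain and
   [2 * Q] is what [apex_step] requires. *)
exists (Q * C), (C * (K + 2 * Q)); split; try by rewrite muln_gt0 ?Q0 ?C0 // addn_gt0 K0.
move=> G S B nm uS sS hS KB.
have K'0 : 0 < C * (K + 2 * Q) by rewrite muln_gt0 C0 addn_gt0 K0.
have [lB|nlB] := boolP (light R c (isolate S) B).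
  by exists S, B; split=> //; [lia | exact: leq_pmull].
have [|s [B1 [sS' B1B aS hB]]] := apex_step c0 Q0 _ nlB.
  by apply: leq_trans KB; rewrite mulnC leq_mul2l leq_addl orbT.
have K1 : K <= #|B1|.
  rewrite -(leq_pmul2l C0); apply: leq_trans hB; apply: leq_trans KB.
  by rewrite leq_mul2l leq_addr orbT.
have [||||S' [B' [sS1 B'B cB lB]]] := IH G (s :: S) B1 nm.
- by rewrite /= sS'.
- by rewrite /= addSnnS.
- move=> s'; rewrite inE => /orP[/eqP ->//|s'S].
  exact: apex_shrink C0 B1B hB (hS _ s'S).
- exact: K1.
exists S', B'; split=> //; first exact: subset_trans B1B.
rewrite -/C in hB; apply: leq_trans hB _; rewrite -mulnA leq_mul2l; apply/orP; right.
by apply: leq_trans cB _; rewrite leq_mul2r leq_addr orbT.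
Qed.

(** * Growing balls *)

Lemma slow_growth (f : nat -> nat) T h : 0 < f 0 -> f h < T ^ h ->
  exists2 i, i < h & f i.+1 <= T * f i.
Proof.
move=> f0 fh; case slow: [exists i : 'I_h, f i.+1 <= T * f i].
  by have /existsP[i hi] := slow; exists i.
suff : T ^ h <= f h by rewrite leqNgt fh.
suff H i : i <= h -> T ^ i <= f i by apply: H.
elim: i => // i IH ih; apply: ltnW; apply: (@leq_ltn_trans (T * f i)).
  by rewrite expnS leq_mul2l IH ?orbT // ltnW.
by rewrite ltnNge; apply: contraFN slow => le; apply/existsP; exists (Ordinal ih).
Qed.

Section LightStage.
Variables (V : finType) (e : rel V) (r h : nat) (A : {set V}).
Hypothesis e_sym : symmetric e.

Definition nbr (U : {set V}) := [set a in A | [exists u in U, dle e r a u]].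

Lemma nbrS (U U' : {set V}) : U \subset U' -> nbr U \subset nbr U'.
Proof.
move=> /subsetP UU'; apply/subsetP => a; rewrite !inE => /andP[-> /exists_inP[u uU au]].
by apply/exists_inP; exists u => //; apply: UU'.
Qed.

Lemma card_nbrU (U U' : {set V}) : #|nbr (U :|: U')| <= #|nbr U| + #|nbr U'|.
Proof.
apply: leq_trans (leq_card_setU _ _); apply: subset_leq_card; apply/subsetP => a.
rewrite !inE => /andP[-> /exists_inP[u /setUP[uU|uU] au]]; apply/orP; [left | right];
  by apply/exists_inP; exists u.
Qed.

Definition A_ball d v := [set a in A | dle e d v a].

(* Balls grown from the remaining vertices of [B] until they grow slowly, packed
   into [p] full bins, of which [Ub] is the richest, and a last bin [U0]. *)
Lemma pack_balls T M (B : {set V}) : 0 < T -> #|B| < T ^ h ->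
  (forall v, v \in B -> #|A_ball (2 * r * h) v| <= M) ->
  exists (U0 Ub : {set V}) (p : nat),
    [/\ U0 \subset B, Ub \subset B, #|nbr U0| <= M, #|nbr Ub| <= 2 * M &
        p * M.+1 + #|nbr U0| <= #|nbr B| /\ #|B| <= T * (#|U0| + p * #|Ub|)].
Proof.
move=> T0; move En: #|B| => n; elim/ltn_ind: n B En => n IH B En nT hM.
have [B0|[v vB]] := set_0Vmem B.
  exists set0, set0, 0; rewrite sub0set -En B0 cards0.
  suff -> : nbr set0 = set0 by rewrite cards0.
  by apply/setP => a; rewrite !inE; apply/andP => -[_ /exists_inP[u]]; rewrite inE.
pose ball i := [set b in B | dle e (2 * r * i) v b].
have ballB i : ball i \subset B by apply/subsetP => b; rewrite inE => /andP[].
have [||i ih gr] := @slow_growth (fun i => #|ball i|) T h.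
- by apply/card_gt0P; exists v; rewrite inE vB dle_refl.
- by apply: leq_ltn_trans nT; rewrite -En; apply: subset_leq_card.
(* Discarding the larger ball but keeping only [ball i] costs a factor [T] and leaves a gap of
   [2 * r], so the [r]-neighbourhoods of [ball i] and [B'] are disjoint. *)
pose B' := B :\: ball i.+1.
have B'B : B' \subset B by apply: subsetDl.
have cB : #|B| <= T * #|ball i| + #|B'|.
  have := cardsID (ball i.+1) B; rewrite -/B' (setIidPr (ballB _)) => <-.
  by rewrite leq_add2r.
have ltB' : #|B'| < n.
  rewrite -En; apply: proper_card; apply/properP; split=> //.
  by exists v; rewrite // !inE vB dle_refl.
have [U0 [Ub [p [U0B UbB cU0 cUb [cp cU]]]]] := IH _ ltB' B' erefl
  (ltn_trans ltB' nT) (fun v vB' => hM v (subsetP B'B v vB')).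
have nb : #|nbr (ball i)| + #|nbr B'| <= #|nbr B|.
  suff dis : nbr (ball i) :&: nbr B' = set0.
    apply: (@leq_trans #|nbr (ball i) :|: nbr B'|); first by rewrite cardsU dis cards0 subn0.
    by rewrite subset_leq_card // subUset !nbrS.
  apply/setP => a; rewrite !inE; apply/negP => /andP[/andP[_ /exists_inP[u]]].
  rewrite inE => /andP[uB vu] au /andP[_ /exists_inP[u' /setDP[u'B]]].
  rewrite inE u'B /= => /negP nvu' au'; apply: nvu'.
  have -> : 2 * r * i.+1 = 2 * r * i + (r + r) by lia.
  apply: dle_trans vu _; apply: dle_trans _ au'; by rewrite dle_sym.
have nM : #|nbr (ball i)| <= M.
  apply: leq_trans (hM v vB); apply: subset_leq_card; apply/subsetP => a.
  rewrite !inE => /andP[-> /exists_inP[u]]; rewrite inE => /andP[uB vu] au /=.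
  apply: (@dle_mono _ _ (2 * r * i + r)); first by nia.
  by apply: dle_trans vu _; rewrite dle_sym.
pose W := U0 :|: ball i.
have WB : W \subset B by rewrite subUset (subset_trans U0B B'B) ballB.
have cW : #|W| = #|U0| + #|ball i|.
  rewrite cardsU; suff -> : U0 :&: ball i = set0 by rewrite cards0 subn0.
  apply/setP => b; rewrite in_setI in_set0; apply/negP => /andP[/(subsetP U0B)].
  rewrite !inE => /andP[nb1 bB] /andP[_ vb]; move: nb1; rewrite bB /= (dle_mono _ vb) //.
  by rewrite leq_mul2l leqnSn orbT.
have nW := card_nbrU U0 (ball i); rewrite -/W in nW.
rewrite En in cB.
(* A bin whose neighbourhood exceeds [M] is closed as full; it is at most [2 * M], both pieces being
   at most [M]. *)
case: (leqP (#|nbr U0| + #|nbr (ball i)|) M) => hMW.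
  exists W, Ub, p; split=> //; first exact: subset_trans B'B.
  - exact: leq_trans hMW.
  - by split; [lia | rewrite cW; nia].
have n0 : #|nbr set0| = 0.
  apply/eqP; rewrite cards_eq0; apply/eqP/setP => a; rewrite !inE.
  by apply/andP => -[_ /exists_inP[u]]; rewrite inE.
case: (leqP #|W| #|Ub|) => WU.
  exists set0, Ub, p.+1; rewrite sub0set n0 cards0; split=> //.
  - exact: subset_trans B'B.
  - split; first by lia.
    by rewrite add0n; nia.
exists set0, W, p.+1; rewrite sub0set n0 cards0; split=> //; first by lia.
split; first by lia.
by rewrite add0n; nia.
Qed.

(** A maximum scattered family of vertices with heavy balls in [A] has at most [2 * k] members, as
    these balls are disjoint in [A]; balls of twice the radius around them cover all heavy vertices.
    Lightness leaves half of [B], to which [pack_balls] applies with [M] about [#|A| / (2 * k)]. *)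
Lemma light_select k T (B : {set V}) : 0 < k -> 0 < T -> #|B| < T ^ h ->
  8 * k <= #|B| -> light (2 * (2 * r * h)) (8 * k) e B ->
  exists U : {set V}, [/\ U \subset B, #|B| <= 4 * k * T * #|U| & k * #|nbr U| <= #|A|].
Proof.
move=> k0 T0 BT kB /forallP lB; set R1 := 2 * r * h.
pose heavy b := #|A| < #|A_ball R1 b| * (2 * k).
pose B1 := [set b in B | heavy b].
pose P (F : {set V}) := scattered e (R1 + R1) F && (F \subset B1).
have P0 : P set0.
  by rewrite /P sub0set andbT; apply/scatteredP => x y; rewrite inE.
case: (arg_maxnP (fun F : {set V} => #|F|) P0) => F /andP[/scatteredP sF FB1] maxF.
have cF : #|F| <= 2 * k.
  have sumF : \sum_(f in F) #|A_ball R1 f| <= #|A|.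
    have E f : #|A_ball R1 f| = \sum_(a in A) dle e R1 f a.
      by rewrite -sum1dep_card -big_mkcondr /= big_mkcondr; apply: eq_bigr => a _; case: dle.
    rewrite (eq_bigr _ (fun f _ => E f)) exchange_big /= -sum1_card.
    apply: leq_sum => a _; case some: [exists f in F, dle e R1 f a]; last first.
      rewrite big1 // => f fF; apply/eqP; rewrite eqb0.
      by apply: contraFN some => fa; apply/exists_inP; exists f.
    have /exists_inP[f fF fa] := some.
    rewrite (bigD1 f) //= big1 ?addn0 ?leq_b1 // => g /andP[gF gf].
    apply/eqP; rewrite eqb0; apply: contra (sF g f gF fF gf) => ga.
    by apply: dle_trans ga _; rewrite dle_sym.
  have : \sum_(f in F) #|A|.+1 <= \sum_(f in F) #|A_ball R1 f| * (2 * k).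
    by apply: leq_sum => f /(subsetP FB1); rewrite inE => /andP[].
  rewrite sum_nat_const -big_distrl /= => h1.
  have {sumF} h2 := leq_trans h1 (leq_mul sumF (leqnn (2 * k))).
  rewrite -(leq_pmul2r (ltn0Sn #|A|)); apply: leq_trans h2 _.
  by rewrite mulnC leq_mul2l leqnSn orbT.
have cB1 : #|B1| * 2 <= #|B|.
  pose bb f := [set b in B | dle e (2 * R1) f b].
  have sub : B1 \subset \bigcup_(f in F) bb f.
    apply/subsetP => b bB1; have bB : b \in B by move: bB1; rewrite inE => /andP[].
    have [bF|bF] := boolP (b \in F).
      by apply/bigcupP; exists b => //; rewrite inE bB dle_refl.
    case ex: [exists f in F, dle e (2 * R1) f b].
      by have /exists_inP[f fF fb] := ex; apply/bigcupP; exists f; rewrite // inE bB.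
    have : P (b |: F).
      apply/andP; split; last by rewrite subUset sub1set bB1.
      apply: scattered_setU1 => //; first exact/scatteredP.
      move=> y yF; apply: contraFN ex => by_; apply/exists_inP; exists y => //.
      by rewrite dle_sym // mul2n -addnn.
    by move/maxF; rewrite /= cardsU1 bF ltnn.
  (* The centre missing from the light ball is absorbed by [8 * k <= #|B|], whence the factor 2. *)
  have bbB f : #|bb f| * (8 * k) <= 2 * #|B|.
    have := lB f; rewrite -/R1; set pb := [set _ in _ | _] => h1.
    have : #|bb f| <= #|pb|.+1.
      apply: (@leq_trans #|f |: pb|).
        apply: subset_leq_card; apply/subsetP => b; rewrite !inE => /andP[-> ->].
        by case: eqP.
      by apply: leq_trans (leq_card_setU _ _) _; rewrite cards1.
    nia.
  have h1 : #|B1| * (8 * k) <= #|F| * (2 * #|B|).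
    apply: leq_trans (leq_mul (subset_leq_card sub) (leqnn _)) _.
    apply: leq_trans (leq_mul (card_bigcup_le _ _) (leqnn _)) _.
    by rewrite big_distrl /= -sum_nat_const; apply: leq_sum => f _; apply: bbB.
  have : #|B1| * (8 * k) <= 2 * k * (2 * #|B|).
    by apply: leq_trans h1 _; rewrite leq_mul2r cF orbT.
  rewrite -(leq_pmul2r (_ : 0 < 4 * k)); last by rewrite muln_gt0.
  nia.
pose B2 := B :\: B1.
have cB2 : #|B| <= 2 * #|B2|.
  have B1B : B1 \subset B by apply/subsetP => b; rewrite inE => /andP[].
  by move: (cardsID B1 B); rewrite -/B2 (setIidPr B1B); lia.
pose M := #|A| %/ (2 * k).
have kk0 : 0 < 2 * k by rewrite muln_gt0.
have [||U0 [Ub [p [U0B UbB c0 cb [cp cU]]]]] := @pack_balls T M B2 T0.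
- by apply: leq_ltn_trans BT; apply: subset_leq_card; apply: subsetDl.
- move=> v /setDP[vB]; rewrite inE vB /= -leqNgt.
  by rewrite /M leq_divRL.
have kM : k * (2 * M) <= #|A|.
  by rewrite mulnCA mulnA mulnC; apply: leq_divM.
have cA : #|nbr B2| <= #|A|.
  by apply: subset_leq_card; apply/subsetP => a; rewrite inE => /andP[].
have AM : #|A| < M.+1 * (2 * k) by rewrite /M; apply: ltn_ceil.
(* Each full bin uses up [M.+1] vertices of [A], and none is counted twice. *)
have p2k : p < 2 * k.
  rewrite -(ltn_pmul2r (ltn0Sn M)) [X in _ < X]mulnC; apply: leq_ltn_trans AM.
  by apply: leq_trans cA; apply: leq_trans cp; apply: leq_addr.
(* In [4 * k * T], a factor 2 is due to dropping [B1], [T] to the discarded shells, and [2 * k] to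
   the at most [p.+1] bins. *)
have BU (U : {set V}) : #|U0| <= #|U| -> #|Ub| <= #|U| -> #|B| <= 4 * k * T * #|U|.
  move=> h0 hb; apply: leq_trans cB2 _.
  have : #|U0| + p * #|Ub| <= 2 * k * #|U|.
    apply: (@leq_trans (p.+1 * #|U|)).
      by rewrite mulSn leq_add // leq_mul2l hb orbT.
    by rewrite leq_mul2r p2k orbT.
  move=> h1; apply: leq_trans (leq_mul (leqnn 2) (leq_trans cU (leq_mul (leqnn T) h1))) _.
  by rewrite -(mulnA 2 k) !mulnA; apply: eq_leq; lia.
have [le|lt] := leqP #|U0| #|Ub|.
  exists Ub; split; first by apply: subset_trans UbB (subsetDl _ _).
    exact: BU.
  by apply: leq_trans kM; rewrite leq_mul2l cb orbT.
exists U0; split; first by apply: subset_trans U0B (subsetDl _ _).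
  by apply: BU => //; apply: ltnW.
by apply: leq_trans kM; rewrite leq_mul2l (leq_trans c0) ?orbT // leq_pmull.
Qed.

End LightStage.

(** * Combining the metric and the logical part *)

Lemma homogeneous_pair (C : graph -> Prop) (phi : formula 2) k h :
  nowhere_dense C -> 0 < k ->
  exists2 L, 0 < L & forall G : graph, C G -> forall (A B : {set G}) T,
    0 < T -> #|B| < T ^ h -> L <= #|B| ->
    exists A' B' : {set G},
      [/\ A' \subset A, B' \subset B, [disjoint A' & B'],
          k * #|A :\: A'| <= #|A| & #|B| <= L * T * #|B'|] /\
      forall a, a \in A' -> {in B' &, forall b b', models2 phi a b = models2 phi a b'}.
Proof.
move=> hC k0; pose q := qdepth phi; pose N := q.+2.
(* [N] counts the two free variables and one variable per nested quantifier; [r] is the separation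
   at which [loceq_cat] glues games of [f] rounds. *)
case Eloc: (locality N q) => [D f]; pose r := D * f.+1.
pose R := 2 * (2 * r * h).
have [H hH] := hC R.+1.
have c0 : 0 < 8 * k by rewrite muln_gt0.
have [Q [K [_ K0 hK]]] := isolate_until_light H R #|H| c0.
pose color := {ffun 'I_#|H| -> bool * bool}.
pose M := #|ltype color D f 1|.
have L0 : 0 < K * (8 * k) * M.+1 by rewrite !muln_gt0 K0 k0.
exists (K * (8 * k) * M.+1) => // G CG A B T T0 BT LB.
have KB : K * (8 * k) <= #|B| by apply: leq_trans LB; apply: leq_pmulr.
have [||||S [B1 [sS B1B cB1 lB1]]] := hK G [::] B (hH G CG) => //.
  by apply: leq_trans KB; apply: leq_pmulr.
have [||U [UB1 cU cN]] := @light_select G _ r h A (isolate_sym S) k T B1 k0 T0 _ _ lB1.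
- by apply: leq_ltn_trans BT; apply: subset_leq_card.
- by rewrite -(leq_pmul2l K0); apply: leq_trans cB1.
pose e := isolate S; pose kap : G -> color := isolate_color S #|H|.
have [B' [B'U cB' hB']] := pigeonhole_fiber (fun b => code e kap D f [tuple b]) U.
have UB : U \subset B by apply: subset_trans B1B.
(* Removing from [A] everything within [r] of [U] also gives disjointness, as each vertex is within
   [r] of itself. *)
exists (A :\: nbr e r A U), B'; split; first split.
- exact: subsetDl.
- exact: subset_trans UB.
- apply/pred0P => b /=; apply/negP => /andP[/setDP[bA bN] bB'].
  case/negP: bN; rewrite inE bA; apply/exists_inP; exists b; last exact: dle_refl.
  exact: (subsetP B'U).
- apply: leq_trans cN; rewrite leq_mul2l; apply/orP; right; apply: subset_leq_card.
  by apply/subsetP => a; rewrite !inE; case: (a \in A); rewrite ?andbF ?andbT // negbK.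
- apply: leq_trans cB1 _; rewrite -!mulnA leq_mul2l; apply/orP; right.
  apply: leq_trans cU _; apply: leq_trans (leq_mul (leqnn _) cB') _.
  rewrite -/M; have := leqnSn M; nia.
move=> a /setDP[aA aN] b b' bB' b'B'.
have nfar x : x \in B' -> ~~ dle e r a x.
  move=> xB'; apply: contra aN => ax; rewrite inE aA; apply/exists_inP; exists x => //.
  exact: (subsetP B'U).
apply: (@sat_loceq G _ e kap (isolate_sym S) _ N _ phi q) => //.
- by move=> z p p'; apply: isolate_atoms.
(* The trivial game on [a] against itself is glued to the game on [b] and [b'], which have equal
   codes. *)
- rewrite Eloc; apply: (loceq_cat (isolate_sym S) (z := [:: (a, a)]) (z' := [:: (b, b')])).
  + by move=> p p'; rewrite !inE => /eqP -> /eqP ->; split; apply: nfar.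
  + by apply: loceq_diag => p; rewrite inE => /eqP ->.
  + exact: (code_loceq (hB' b b' bB' b'B')).
Qed.

(** * From integer bounds to real exponents *)

Import Order.TTheory GRing.Theory Num.Theory.
Local Open Scope ring_scope.

(** [T] is the integer part of the root of order [2 * k] of [n], plus one; that root is at least 1,
    so the rounding costs a factor at most 2. *)
Lemma root_upper_bound (R : realType) (eps : R) (k n : nat) : (0 < k)%N -> (0 < n)%N ->
  k%:R^-1 <= eps ->
  exists T : nat, [/\ (0 < T)%N, (n < T ^ (2 * k))%N & T%:R <= 2 * n%:R `^ (eps / 2) :> R].
Proof.
move=> k0 n0 ke; set h := (2 * k)%N.
have h0 : (h%:R : R) != 0 by rewrite pnatr_eq0 muln_eq0 /= -lt0n.
pose y : R := n%:R `^ (h%:R^-1).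
have n1 : 1 <= (n%:R : R) by rewrite ler1n.
have y1 : 1 <= y by rewrite -(powRr0 n%:R); apply: ler_powR => //; rewrite invr_ge0.
have yx : y <= n%:R `^ (eps / 2).
  apply: ler_powR => //; rewrite natrM invfM mulrC.
  by rewrite ler_pM2r // invr_gt0.
have yh : y ^+ h = n%:R.
  by rewrite -powR_mulrn ?powR_ge0 // -powRrM mulVf // powRr1.
have := truncn_itv (le_trans ler01 y1); set T := Num.truncn y => /andP[Ty yT].
exists T.+1; split=> //.
- by rewrite -(ltr_nat R) natrX -yh ltrXn2r ?(le_trans ler01) ?nnegrE //; lia.
- rewrite -natr1 mulr_natl mulr2n; apply: lerD (le_trans Ty yx) (le_trans y1 yx).
Qed.

Theorem theorem4 (R : realType) (C : graph -> Prop) (hC : nowhere_dense C)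
    (d : nat) (hd : (0 < d)%N) (eps : R) (heps : 0 < eps) (phi : formula 2) :
  exists k0 : nat, forall G : graph, C G -> forall A B : {set G},
    (k0 <= #|A :|: B|)%N ->
    exists A' B' : {set G},
      [/\ A' \subset A, B' \subset B & [disjoint A' & B']] /\
      [/\ (1 - eps) * #|A|%:R <= #|A'|%:R :> R,
          #|B|%:R / (#|A :|: B|%:R `^ eps) <= #|B'|%:R :> R &
          forall a : G, a \in A' ->
            (forall b : G, b \in B' -> models2 phi a b) \/
            (forall b : G, b \in B' -> models2 (FNot phi) a b)].
Proof.
(* This [k] serves twice: the lost fraction of [A] is at most [1 / k], and [2 * k] growth steps give
   a factor of order at most [n^(eps/2)]. *)
have [k k0 ke] : exists2 k, (0 < k)%N & k%:R^-1 <= eps.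
  have ei : 0 < eps^-1 by rewrite invr_gt0.
  have b := archi_boundP (ltW ei); exists (Num.bound eps^-1).
    by rewrite -(ltr_nat R); apply: lt_trans b.
  by rewrite -[eps in X in _ <= X]invrK lef_pV2 ?posrE ?(ltW b) ?(lt_trans ei b).
have [L L0 hL] := @homogeneous_pair C phi k (2 * k) hC k0.
(* From [m] on, [n^(eps/2)] is at least [2 * L], which absorbs all constants. *)
pose m := Num.bound ((2 * L%:R : R) `^ (2 / eps)).
exists (maxn m (maxn k 1)) => G CG A B; rewrite !geq_max => /and3P[mn kn n0].
set n := #|A :|: B| in mn kn n0 *; pose x : R := n%:R `^ (eps / 2).
have xx : n%:R `^ eps = x * x.
  by rewrite -powRD ?implybT // -?splitr // (pnatr_eq0 R) -lt0n n0 implybT.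
have Lx : 2 * L%:R <= x.
  have e2 : 0 <= eps / 2 by rewrite divr_ge0 // ltW.
  have L2 : 0 <= 2 * L%:R :> R by rewrite mulr_ge0.
  have -> : 2 * L%:R = ((2 * L%:R : R) `^ (2 / eps)) `^ (eps / 2).
    by rewrite -powRrM mulrA divfK ?gt_eqF // divff ?pnatr_eq0 // powRr1.
  apply: ge0_ler_powR => //; rewrite ?nnegrE ?powR_ge0 //.
  apply: ltW; apply: lt_le_trans (archi_boundP _) _; first exact: powR_ge0.
  by rewrite ler_nat.
have L1 : 1 <= L%:R :> R by rewrite ler1n.
have x1 : 1 <= x by lra.
have keepA (A' : {set G}) : A' \subset A -> (k * #|A :\: A'| <= #|A|)%N ->
    (1 - eps) * #|A|%:R <= #|A'|%:R :> R.
  move=> A'A; rewrite -(ler_nat R) natrM => kA.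
  have -> : #|A'|%:R = #|A|%:R - #|A :\: A'|%:R :> R.
    by rewrite -(cardsID A' A) (setIidPr A'A) natrD addrK.
  rewrite mulrBl mul1r lerD2l lerN2; apply: le_trans (ler_wpM2r (ler0n _ _) ke).
  by rewrite ler_pdivlMl ?ltr0n.
(* If [B] is smaller than [L], one vertex is large enough for [B'], and a singleton is
   homogeneous. *)
have [LB|BL] := leqP L #|B|; last first.
  have cB (b : G) : #|B|%:R / n%:R `^ eps <= #|[set b]|%:R :> R.
    rewrite cards1 xx ler_pdivrMr ?mul1r; last by rewrite mulr_gt0 // (lt_le_trans ltr01).
    have : #|B|%:R <= L%:R :> R by rewrite ler_nat ltnW.
    nra.
  have hom (a b : G) : (forall b', b' \in [set b] -> models2 phi a b') \/
     (forall b', b' \in [set b] -> models2 (FNot phi) a b').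
    by have [h|h] := boolP (models2 phi a b); [left | right] => b' /set1P ->.
  have [BA|] := boolP (B \subset A); last first.
    case/subsetPn => b bB bA; exists A, [set b]; split.
      by rewrite sub1set disjoint_sym disjoints1.
    split; [| exact: cB | by move=> a _; exact: hom].
    by apply: keepA; rewrite // setDv cards0 muln0.
  have [B0|[b bB]] := set_0Vmem B.
    exists A, set0; rewrite B0 sub0set disjoint_sym; split.
      by split=> //; rewrite -setI_eq0 set0I.
    split; first by apply: keepA; rewrite // setDv cards0 muln0.
      by rewrite cards0 mul0r.
    by move=> a _; left => b; rewrite inE.
  (* Here [A] is the whole union, so it has at least [k] vertices and can lose one. *)
  exists (A :\ b), [set b]; split.
    by rewrite sub1set bB subD1set disjoint_sym disjoints1 !inE eqxx.
  split; [| exact: cB | by move=> a _; exact: hom].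
  apply: keepA; first exact: subD1set.
  have -> : A :\: (A :\ b) = [set b].
    by rewrite setDDr setDv set0U; apply/setIidPr; rewrite sub1set (subsetP BA).
  by rewrite cards1 muln1; move: kn; rewrite /n (setUidPl BA).
have [T [T0 nT Tx]] := root_upper_bound k0 n0 ke.
have [|A' [B' [[A'A B'B dAB cA cB] hom]]] := hL G CG A B T T0 _ LB.
  by apply: leq_ltn_trans nT; apply: subset_leq_card; apply: subsetUr.
exists A', B'; split=> //; split.
- exact: keepA.
- rewrite xx ler_pdivrMr; last by rewrite mulr_gt0 // (lt_le_trans ltr01).
  have : #|B|%:R <= L%:R * T%:R * #|B'|%:R :> R by rewrite -!natrM ler_nat.
  move/le_trans; apply; rewrite [leRHS]mulrC; apply: ler_wpM2r => //.
  (* The product [L * T] is at most [2 * L * x], hence at most [x * x], which is [n^eps]. *)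
  apply: (@le_trans _ _ (L%:R * (2 * x))); first by apply: ler_wpM2l.
  by rewrite mulrCA mulrA; apply: ler_wpM2r => //; apply: le_trans x1.
- move=> a aA'; case ex: [exists b in B', models2 phi a b].
    have /exists_inP[b bB' ab] := ex; left => b' b'B'.
    by rewrite (hom a aA' b' b).
  right => b bB'; have := negbT ex; rewrite negb_exists_in => /forall_inP; exact.
Qed.
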